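(* For a prime power $q=p^k$ ($p$ prime, $k\ge 1$), let $\mathrm{Aff}(\mathbb{F}_q)$ be the affine group over the field $\mathbb{F}_q$ with $q$ elements. Then: (1) there are no Leinster affine groups; (2) the cyclic group of order $2$ is the only quasi-Leinster affine group; (3) an affine group $\mathrm{Aff}(\mathbb{F}_q)$ is almost Leinster if and only if $q$ is prime and $q-1$ is perfect.
   Context: An affine group here means a group $\mathrm{Aff}(\mathbb{F}_q)=\left\{\begin{pmatrix} a & b\\ 0 & 1\end{pmatrix} : a\in\mathbb{F}_q^*,\ b\in\mathbb{F}_q\right\}$ under matrix multiplication, for some prime power $q$. A positive integer $n$ is perfect if $\sum_{d\mid n} d=2n$. For a finite group $G$ let $D(G)=\sum_{N\trianglelefteq G}|N|$, the sum of the orders of all normal subgroups of $G$ (including the trivial subgroup and $G$ itself). The group $G$ is Leinster if $D(G)=2|G|$, quasi-Leinster if $D(G)=2|G|+1$, and almost Leinster if $D(G)=2|G|-1$.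
   Formalization: The names ''quasi-Leinster'' and ''almost Leinster'' are interchanged in (2) and (3): with D(G)=2|G|+1 as quasi and 2|G|-1 as almost, the cyclic group of order 2 (D=3) is almost Leinster, and Aff(F_7) (D=85=2·42+1) is quasi-Leinster, so the claims as worded are false. *)

(* Defs.v *)
From mathcomp Require Import all_boot all_order all_algebra all_fingroup all_solvable all_field.

Set Implicit Arguments.
Unset Strict Implicit.
Unset Printing Implicit Defensive.

Import GRing.Theory.

Definition prime_power (q : nat) : Prop :=
  exists p k : nat, [/\ prime p, 0 < k & q = p ^ k].

(* [divisors 0] is empty, hence the positivity requirement. *)
Definition perfect (n : nat) : Prop :=
  0 < n /\ \sum_(d <- divisors n) d = 2 * n.

(* "Quasi" is excess 1 and "almost" is deficiency 1, as for quasiperfect and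
   almost perfect numbers.  For the cyclic group of order 2, normal_sum is
   3 = 2 * 2 - 1, so that group is almost Leinster and not quasi-Leinster;
   Aff(F_7) has normal_sum 1 + 7 * 12 = 2 * 42 + 1 and is quasi-Leinster.  The
   published statement on affine groups attaches the two names the other way
   round, which is false with these definitions; the theorem about [Aff]
   therefore interchanges the two names. *)
Section NormalSubgroupSum.
Variable gT : finGroupType.
Implicit Type G : {group gT}.

Definition normal_sum G : nat := \sum_(N : {group gT} | (N <| G)%g) #|N|.

Definition Leinster G : Prop := normal_sum G = 2 * #|G|.
Definition quasi_Leinster G : Prop := normal_sum G = 2 * #|G| + 1.

(* As 2 * #|G| > 0, the truncated subtraction is the true one. *)
Definition almost_Leinster G : Prop := normal_sum G = 2 * #|G| - 1.
End NormalSubgroupSum.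

Section AffineGroup.
Variable F : finFieldType.
Local Open Scope ring_scope.

Definition aff_mx (a b : F) : 'M[F]_2 :=
  block_mx (a%:M : 'M_1) (b%:M : 'M_1) (0 : 'M_1) (1%:M : 'M_1).

Definition Aff_set : {set {'GL_2[F]}} :=
  [set u : {'GL_2[F]} | [exists a : F, exists b : F, (a != 0) && (GLval u == aff_mx a b)]].

Lemma aff_mxM a b c d : aff_mx a b *m aff_mx c d = aff_mx (a * c) (a * d + b).
Proof.
rewrite /aff_mx (@mulmx_block _ 1 1 1 1 1 1) -!scalar_mxM.
by rewrite !mulmx0 !mul0mx !mulr1 !addr0 !add0r raddfD.
Qed.

Lemma aff_mx1 : aff_mx 1 0 = 1%:M.
Proof. by rewrite /aff_mx raddf0 -(@scalar_mx_block _ 1 1). Qed.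

Lemma Aff_set_group : group_set Aff_set.
Proof.
apply/group_setP; split.
  rewrite inE; apply/existsP; exists 1; apply/existsP; exists 0.
  by rewrite oner_neq0 aff_mx1; apply/eqP.
move=> u v; rewrite !inE.
case/existsP=> a /existsP[b /andP[a0 /eqP ub]].
case/existsP=> c /existsP[d /andP[c0 /eqP vd]].
apply/existsP; exists (a * c); apply/existsP; exists (a * d + b).
by rewrite mulf_neq0 //= -aff_mxM -ub -vd; apply/eqP.
Qed.

Definition Aff : {group {'GL_2[F]}} := Group Aff_set_group.
End AffineGroup.

(* Main.v *)
Require Import Defs.
From mathcomp Require Import all_boot all_order all_algebra all_fingroup all_solvable all_field.
From mathcomp Require Import zify ring.

(* Every nontrivial normal subgroup of Aff(F_q) contains the translation group
   T, and Aff(F_q)/T is isomorphic to the cyclic group F_q^*, so the normal sum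
   is 1 + q sigma(q-1).  Comparing it with 2q(q-1) + e for e = 0, -1, 1 gives
   q | 1, q | 2, and "q-1 is perfect", respectively.  It remains to see that a
   prime power q = p^k with q-1 perfect is prime.  For p = 2 and k > 1,
   q-1 = 3 mod 4 forces 4 | sigma(q-1) = 2(q-1), absurd.  For p odd,
   q-1 = 2^a M with M = 2^(a+1) - 1 prime by Euler's theorem.  If k is even,
   M divides p^(k/2) - 1 or p^(k/2) + 1; if k > 1 is odd, M equals the odd
   divisor 1 + p + ... + p^(k-1) of q-1; both are impossible by size. *)

Set Implicit Arguments.
Unset Strict Implicit.
Unset Printing Implicit Defensive.

(** * Divisor sums and even perfect numbers *)

Definition sigma (n : nat) : nat := \sum_(d <- divisors n) d.

Lemma sum_divisors_le (s : seq nat) (n : nat) :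
  0 < n -> uniq s -> {in s, forall d, d %| n} -> \sum_(d <- s) d <= sigma n.
Proof.
move=> n0 us sn; have sP : perm_eq s [seq d <- divisors n | d \in s]; last first.
  by rewrite (perm_big _ sP) big_filter /sigma [leqRHS](bigID (mem s)) leq_addr.
apply: uniq_perm; rewrite ?filter_uniq ?divisors_uniq // => d.
rewrite mem_filter -dvdn_divisors //.
by case sd: (d \in s) => //=; rewrite sn.
Qed.

(** The even divisors of 2^(a+1) m are the doubles of the divisors of 2^a m; the odd ones are the
    divisors of m. *)
Lemma sigma_double (a m : nat) :
  odd m -> sigma (2 ^ a.+1 * m) = 2 * sigma (2 ^ a * m) + sigma m.
Proof.
move=> om; have m0 : 0 < m by case: m om.
have n0 b : 0 < 2 ^ b * m by rewrite muln_gt0 expn_gt0.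
have inj2 : injective (muln 2) by move=> x y; lia.
rewrite /sigma [in RHS]big_distrr /= -(big_map (muln 2) xpredT id) -big_cat /=.
apply/perm_big/uniq_perm; first exact: divisors_uniq.
  rewrite cat_uniq map_inj_uniq // !divisors_uniq andbT /=.
  apply/hasPn => d; rewrite -dvdn_divisors // => dm.
  apply/mapP => -[e _ de]; move: om.
  by rewrite -(divnK dm) de oddM oddM /= andbF.
move=> d; rewrite mem_cat -!dvdn_divisors //.
have [od|ed] := boolP (odd d).
  rewrite Gauss_dvdr ?coprimeXr // 1?coprime_sym ?coprime2n //.
  rewrite orb_idl // => /mapP[e _ de]; move: od; rewrite de; lia.
have -> : d = 2 * d./2 by rewrite mul2n even_halfK.
rewrite expnS -mulnA dvdn_pmul2l // mem_map // -dvdn_divisors //.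
rewrite orb_idr // => dm; rewrite (dvdn_trans (dvdn_mull 2 (dvdnn _))) //.
by rewrite (dvdn_trans dm) ?dvdn_mull.
Qed.

Lemma sigma_pow2_mul (a m : nat) :
  odd m -> sigma (2 ^ a * m) = (2 ^ a.+1 - 1) * sigma m.
Proof.
move=> om; elim: a => [|a IH]; first by rewrite mul1n mul1n.
have := expn_gt0 2 a.
rewrite sigma_double // IH !expnS; nia.
Qed.

Lemma even_perfect_mersenne (n : nat) :
  perfect n -> ~~ odd n ->
  exists a m, [/\ n = 2 ^ a * m, m.+1 = 2 ^ a.+1 & prime m].
Proof.
move=> [n0 sn] en; rewrite -/(sigma n) in sn.
have [m om nE] := pfactor_coprime (isT : prime 2) n0.
rewrite coprime2n in om; set a := logn 2 n in nE; rewrite mulnC in nE.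
have a0 : 0 < a by case: (a) nE => // nE; move: en; rewrite nE mul1n om.
have m0 : 0 < m by case: m om {nE}.
have := sigma_pow2_mul a om; rewrite -nE sn {1}nE mulnA -expnS => sm.
(* Evenness of n enters here: the factor 2^(a+1) - 1 is at least 3, so its cofactor c in m will be a
   proper divisor of m. *)
have a2 : 4 <= 2 ^ a.+1 by rewrite (@leq_exp2l 2 2).
(* [sm] now reads 2^(a+1) m = (2^(a+1) - 1) sigma(m), and consecutive numbers are coprime. *)
have /dvdnP[c mE] : 2 ^ a.+1 - 1 %| m.
  rewrite -(@Gauss_dvdr _ (2 ^ a.+1)) ?sm ?dvdn_mulr //.
  by rewrite subn1 coprimePn // expn_gt0.
have smE : sigma m = c + m.
  apply/eqP; rewrite -(eqn_pmul2l (_ : 0 < 2 ^ a.+1 - 1)); last lia.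
  rewrite -sm; nia.
(* sigma m is the sum of just the two divisors c and m, so c = 1 and m is prime. *)
have c0 : 0 < c by case: (c) mE m0 => // ->.
have cm : c < m by rewrite mE ltn_Pmulr //; lia.
have c1 : c = 1.
  apply/eqP/negPn/negP => c1.
  have := @sum_divisors_le [:: 1; c; m] m m0.
  rewrite !big_cons big_nil smE /= !inE => le.
  have : 1 + (c + (m + 0)) <= c + m; last lia.
  apply: le; first by lia.
  move=> d; rewrite !inE => /or3P[] /eqP-> //; by rewrite ?dvd1n // mE dvdn_mulr.
exists a, m; split=> //; first lia.
apply/primeP; split=> [|d dm]; first lia.
apply/norP => -[d1 dm'].
have := @sum_divisors_le [:: 1; d; m] m m0.
rewrite !big_cons big_nil smE c1 /= !inE => le.
have : 1 + (d + (m + 0)) <= 1 + m.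
  apply: le; first by lia.
  by move=> e; rewrite !inE => /or3P[] /eqP->; rewrite ?dvd1n.
by have := dvdn_gt0 m0 dm; lia.
Qed.

(* Pairing d with n/d: one is 1 and the other is 3 modulo 4. *)
Lemma dvdn4_sigma (n : nat) : n %% 4 = 3 -> 4 %| sigma n.
Proof.
move=> n4; have n0 : 0 < n by lia.
have dn4 d : d %| n ->
    (n %/ d) %% 4 = 3 /\ d %% 4 = 1 \/ (n %/ d) %% 4 = 1 /\ d %% 4 = 3.
  move=> /divnK nE; move: n4; rewrite -{1}nE -modnMm.
  have := ltn_pmod (n %/ d) (isT : 0 < 4); have := ltn_pmod d (isT : 0 < 4).
  by move: (_ %% 4) (d %% 4) => [|[|[|[]]]] // [|[|[|[]]]] //; auto.
have nd : perm_eq (divisors n) [seq n %/ d | d <- divisors n].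
  apply: uniq_perm; rewrite ?divisors_uniq //.
    rewrite map_inj_in_uniq ?divisors_uniq // => d e.
    rewrite -!dvdn_divisors // => /divnK dn /divnK en de; nia.
  move=> d; rewrite -dvdn_divisors //; apply/idP/mapP => [dn|[e]].
    by exists (n %/ d); rewrite -?dvdn_divisors ?dvdn_div ?divnA ?mulKn.
  by rewrite -dvdn_divisors // => en ->; rewrite dvdn_div.
rewrite /sigma (bigID (fun d => d %% 4 == 1)) /=.
(* Reindexing the second sum by d -> n/d makes both sums run over the divisors d = 1 mod 4, so they
   merge into a sum of terms d + n/d, each divisible by 4. *)
rewrite [X in _ + X](perm_big _ nd) big_map /=.
rewrite [X in _ + X]big_seq_cond.
rewrite (eq_bigl (fun d => (d \in divisors n) && (d %% 4 == 1))).
  rewrite -[X in _ + X]big_seq_cond -big_split /= big_seq_cond.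
  apply: dvdn_sum => d; rewrite -dvdn_divisors // => /andP[/dn4 + /eqP d1]; lia.
move=> d; rewrite -dvdn_divisors //.
case dn: (d %| n) => //=; have := dn4 d dn; lia.
Qed.

(** * Prime powers whose predecessor is perfect *)

Lemma dvdn_mul_prime_odd (a m d : nat) :
  prime m -> odd d -> d %| 2 ^ a * m -> d = 1 \/ d = m.
Proof.
move=> pm od; rewrite Gauss_dvdr ?coprimeXr // 1?coprime_sym ?coprime2n //.
by case/primeP: pm => _ h /h /orP[] /eqP; auto.
Qed.

Lemma perfect_prime_power_pred (q : nat) :
  prime_power q -> perfect (q - 1) -> prime q.
Proof.
move=> [p [k [pp k0 ->]]] pf; have p2 := prime_gt1 pp.
case: k k0 pf => [//|[_ _|k _ pf]]; first by rewrite expn1.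
exfalso.
case: (even_prime pp) => [p2E|op].
  have q4 : (p ^ k.+2 - 1) %% 4 = 3.
    have := expn_gt0 2 k; rewrite p2E !expnS; lia.
  have := dvdn4_sigma q4; case: pf => _; rewrite -/(sigma _) => ->; lia.
have en : ~~ odd (p ^ k.+2 - 1).
  by rewrite oddB ?expn_gt0 ?prime_gt0 // oddX op.
have [a [m [nE mE pm]]] := even_perfect_mersenne pf en.
have m2 := prime_gt1 pm.
(* The exponent is k + 2, of the same parity as k. *)
have [ok|ek] := boolP (odd k).
  have : p ^ k.+2 - 1 = p.-1 * \sum_(i < k.+2) p ^ i by rewrite subn1 predn_exp.
  set S := \sum_(i < _) _ => nS.
  have oS : odd S.
    suff oSj j : odd (\sum_(i < j) p ^ i) = odd j by rewrite oSj /= negbK.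
    by elim: j => [|j IH]; rewrite ?big_ord0 // big_ord_recr oddD IH oddX op orbT /= addbT.
  have S3 : 1 + p + p ^ 2 <= S.
    case: k ok @S {nE en pf nS oS} => // k _; rewrite /= !big_ord_recl /= /bump /=.
    by rewrite expn0 expn1; lia.
  have [||//] := @dvdn_mul_prime_odd a m S pm oS; first by rewrite -nE nS dvdn_mull.
    by nia.
  (* Cancelling S = m leaves p - 1 = 2^a, so m = 2p - 3, which is less than 1 + p + p^2. *)
  move=> SE; have : p.-1 = 2 ^ a.
    apply/eqP; rewrite -(eqn_pmul2r (_ : 0 < m)) -?nE ?nS ?SE //; lia.
  have pp2 : p <= p ^ 2 by rewrite -mulnn leq_pmull // ltnW.
  by move=> pE; move: mE S3; rewrite SE expnS -pE; clear -p2 pp2; lia.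
pose r := p ^ (k.+2./2).
have rE : p ^ k.+2 = r ^ 2 by rewrite -expnM muln2 even_halfK //= negbK.
have r0 : 1 < r by rewrite /r -(exp1n k.+2./2) ltn_exp2r.
have nr : (r - 1) * (r + 1) = 2 ^ a * m by rewrite -nE rE; nia.
have mr : m <= r + 1.
  have : m %| (r - 1) * (r + 1) by rewrite nr dvdn_mull.
  by rewrite Euclid_dvdM // => /orP[] /dvdn_leq; lia.
have : 2 * ((r - 1) * (r + 1)) = m.+1 * m by rewrite nr mulnA -expnS mE.
have or : odd r by rewrite oddX op orbT.
(* Since r >= m - 1, the equation 2(r^2 - 1) = m(m + 1) gives 2(m - 2) <= m + 1, so m <= 5 and then
   r < 5. The only odd candidate, r = 3, would need m(m + 1) = 16. *)
clear -mr m2 r0 or => h; have m5 : m <= 5 by nia.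
have r5 : r < 5 by nia.
clear mr; case: r r0 or r5 h => [|[|[|[|[|r]]]]] // _ _ _.
by case: m m2 m5 => [|[|[|[|[|[|m]]]]]].
Qed.

(** * Normal sums of groups with a cyclic quotient *)

Section CyclicQuotient.

Import GroupScope.

(** A cyclic group has exactly one subgroup of each order dividing its own. Each #|K| is written as
    a sum over divisors d with the single term d = #|K|, so that the two sums can be exchanged. *)
Lemma sum_card_subgroups_cyclic (gT : finGroupType) (C : {group gT}) :
  cyclic C -> (\sum_(K : {group gT} | K \subset C) #|K|)%N = sigma #|C|.
Proof.
case/cyclicP=> a defC; rewrite defC -orderE.
rewrite (eq_bigr (fun K : {group gT} => \sum_(d <- divisors #[a] | #|K| == d) d)%N).
  rewrite (exchange_big_dep xpredT) //= /sigma !big_seq.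
  apply: eq_bigr => d; rewrite -dvdn_divisors ?order_gt0 // => da.
  under eq_bigl => K do rewrite -(in_set (fun K : {group gT} => (K \subset <[a]>) && (#|K| == d))).
  by rewrite cycle_sub_group // big_set1.
move=> K Ka; rewrite -big_filter.
rewrite (_ : [seq _ <- _ | _] = [:: #|K|]) ?big_seq1 //.
rewrite -[RHS](@filter_pred1_uniq _ (divisors #[a])) ?divisors_uniq //.
  by apply: eq_filter => d; rewrite /= eq_sym.
by rewrite -dvdn_divisors ?order_gt0 // cardSg.
Qed.

(** By the correspondence theorem, the nontrivial normal subgroups are the preimages of the
    subgroups K of G / T, all of them normal because G / T is abelian; each preimage has order #|T|
    * #|K|. *)
Lemma normal_sum_cyclic_quotient (gT : finGroupType) (G T : {group gT}) :
  T <| G -> T :!=: 1 -> cyclic (G / T) ->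
  (forall N : {group gT}, N <| G -> N :!=: 1 -> T \subset N) ->
  normal_sum G = (1 + #|T| * sigma #|G / T|)%N.
Proof.
move=> nTG T1 cGT minT; rewrite /normal_sum (bigD1 1%G) ?normal1 //= cards1.
congr (_ + _)%N; rewrite -sum_card_subgroups_cyclic // big_distrr /=.
rewrite (reindex_onto (fun K => (coset T @*^-1 K)%G) (fun N => (N / T)%G)) /=.
  apply: eq_big => [K|K _]; last by rewrite card_cosetpre.
  rewrite (_ : _ == K); last by apply/eqP/val_inj; rewrite /= cosetpreK.
  rewrite andbT -{1}(quotientGK nTG) cosetpre_normal.
  rewrite sub_abelian_normal ?cyclic_abelian // andb_idr // => _.
  apply: contraNneq T1 => K1; rewrite -subG1.
  have <- : coset T @*^-1 K = 1 by rewrite -[RHS]/(gval 1%G) -K1.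
  exact: sub_cosetpre.
move=> N /andP[nN N1]; apply/val_inj; rewrite /= quotientGK //.
by apply: normalS (minT N nN N1) (normal_sub nN) nTG.
Qed.

End CyclicQuotient.

(** * Structure of the affine group *)

Section AffineGroupStructure.

Variable F : finFieldType.
Import GRing.Theory GroupScope.
Local Open Scope ring_scope.

(** For a = 0 the matrix is singular and [insubd] returns the identity, whence the hypotheses a != 0
    below. *)
Definition aff (a b : F) : {'GL_2[F]} := insubd (1%g : {'GL_2[F]}) (aff_mx a b).

Lemma aff_mx00 (a b : F) : aff_mx a b 0 0 = a.
Proof.
rewrite /aff_mx mxE; case: splitP => // i _; rewrite mxE.
by case: splitP => // j _; rewrite mxE !ord1.
Qed.

Lemma aff_mx01 (a b : F) : aff_mx a b 0 1 = b.
Proof.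
rewrite /aff_mx mxE; case: splitP => // i _; rewrite mxE.
by case: splitP => [[[]]|j _] //; rewrite mxE !ord1.
Qed.

Lemma val_aff (a b : F) : a != 0 -> GLval (aff a b) = aff_mx a b.
Proof.
move=> a0; apply: insubdK; rewrite -topredE /= unitmxE /aff_mx.
by rewrite (@det_ublock _ 1 1) !det_scalar1 mulr1 unitfE.
Qed.

Lemma aff_inj (a b c d : F) :
  a != 0 -> c != 0 -> aff a b = aff c d -> a = c /\ b = d.
Proof.
move=> a0 c0 /(congr1 GLval); rewrite !val_aff // => E.
split; first by rewrite -(aff_mx00 a b) E aff_mx00.
by rewrite -(aff_mx01 a b) E aff_mx01.
Qed.

Lemma affM (a b c d : F) :
  a != 0 -> c != 0 -> (aff a b * aff c d)%g = aff (a * c) (a * d + b).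
Proof.
move=> a0 c0; apply: val_inj; rewrite [LHS]GL_MxE.
by rewrite [RHS]val_aff ?mulf_neq0 // !val_aff // aff_mxM.
Qed.

Lemma aff1 : aff 1 0 = 1%g.
Proof. by apply: val_inj; rewrite [LHS]val_aff ?oner_neq0 ?aff_mx1. Qed.

Lemma affV (a b : F) : a != 0 -> (aff a b)^-1%g = aff a^-1 (- (a^-1 * b)).
Proof.
move=> a0; apply/eqP; rewrite eq_invg_mul affM ?invr_eq0 //.
by rewrite mulfV // mulrN mulVKf // addNr aff1.
Qed.

Lemma mem_aff (a b : F) : a != 0 -> aff a b \in Aff F.
Proof.
move=> a0; rewrite inE; apply/existsP; exists a; apply/existsP; exists b.
by rewrite a0 val_aff /=.
Qed.

Lemma AffP (u : {'GL_2[F]}) :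
  reflect (exists a b, a != 0 /\ u = aff a b) (u \in Aff F).
Proof.
apply: (iffP idP) => [|[a [b [a0 ->]]]]; last exact: mem_aff.
rewrite inE => /existsP[a /existsP[b /andP[a0 /eqP uE]]].
by exists a, b; split=> //; apply: val_inj; rewrite [RHS]val_aff.
Qed.

(** On [Aff F] this is the homomorphism onto F^* whose kernel is the translation group T. Elsewhere
    in GL_2 the corner entry may vanish, and the value is then the default 1. *)
Definition linear_part (u : {'GL_2[F]}) : {unit F} := insubd (1%g : {unit F}) (GLval u 0 0).

Lemma val_linear_part (a b : F) : a != 0 -> val (linear_part (aff a b)) = a.
Proof.
by move=> a0; rewrite /linear_part val_aff // aff_mx00 insubdK // -topredE /= unitfE.
Qed.

Lemma linear_partM : {in Aff F &, {morph linear_part : u v / (u * v)%g}}.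
Proof.
move=> _ _ /AffP[a [b [a0 ->]]] /AffP[c [d [c0 ->]]].
apply: val_inj; rewrite affM // val_linear_part ?mulf_neq0 //.
by rewrite /= -[RHS]/(val _ * val _) !val_linear_part.
Qed.

Canonical linear_part_morphism := Morphism linear_partM.

Lemma im_linear_part : linear_part @* Aff F = [set: {unit F}].
Proof.
apply/setP=> x; rewrite inE; have x0 : val x != 0 by rewrite -unitfE (valP x).
apply/morphimP; exists (aff (val x) 0); rewrite ?mem_aff //.
by apply: val_inj; rewrite [RHS]val_linear_part.
Qed.

Lemma ker_linear_partP (u : {'GL_2[F]}) :
  reflect (exists b, u = aff 1 b) (u \in 'ker linear_part).
Proof.
apply: (iffP idP) => [ku|[b ->]].
  have /AffP[a [b [a0 uE]]] := dom_ker ku.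
  exists b; rewrite uE -(val_linear_part b a0) -uE.
  by rewrite (mker ku).
apply/kerP; first by rewrite mem_aff ?oner_neq0.
by apply: val_inj; rewrite val_linear_part ?oner_neq0.
Qed.

Lemma card_ker_linear_part : #|'ker linear_part| = #|F|.
Proof.
have inj1 : injective (aff 1).
  by move=> b c /aff_inj[]; rewrite ?oner_neq0.
rewrite -(card_imset predT inj1); apply: eq_card => u.
by apply/ker_linear_partP/imsetP => [[b ->]|[b _ ->]]; exists b.
Qed.

Lemma quotient_ker_linear_part :
  Aff F / 'ker linear_part \isog [set: {unit F}].
Proof. by rewrite -im_linear_part first_isog. Qed.

Lemma card_quotient_ker_linear_part :
  #|(Aff F / 'ker linear_part)%g| = (#|F| - 1)%N.
Proof.
by rewrite (card_isog quotient_ker_linear_part) card_finField_unit subn1.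
Qed.

Lemma card_Aff : #|Aff F| = (#|F| * (#|F| - 1))%N.
Proof.
have nK := ker_normal linear_part_morphism.
rewrite -(Lagrange (normal_sub nK)) -card_quotient ?normal_norm //.
by rewrite card_ker_linear_part card_quotient_ker_linear_part.
Qed.

(* A non-translation in N yields every translation as a commutator, and a
   nontrivial translation yields all others by conjugation with homotheties. *)
Lemma ker_linear_part_minimal (N : {group {'GL_2[F]}}) :
  N <| Aff F -> N :!=: 1%g -> 'ker linear_part \subset N.
Proof.
move=> /andP[sNA nNA] /trivgPn[u uN u1].
have nJ x v : x \in N -> v \in Aff F -> (x ^ v)%g \in N.
  by move=> xN vA; rewrite memJ_norm ?(subsetP nNA).
have /AffP[a [b [a0 uE]]] := subsetP sNA u uN.
have n1 := oner_neq0 F.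
apply/subsetP=> _ /ker_linear_partP[c ->].
have [a1|a1] := eqVneq a 1.
  have b0 : b != 0 by apply: contraNneq u1 => b0; rewrite uE a1 b0 aff1.
  have [->|c0] := eqVneq c 0; first by rewrite aff1.
  (* Conjugating the translation by b with the homothety of ratio d gives the translation by b/d. *)
  pose d := b / c; have cb0 : d != 0 by rewrite mulf_neq0 ?invr_eq0.
  suff -> : aff 1 c = (u ^ aff d 0)%g by rewrite nJ ?mem_aff.
  rewrite /conjg affV // uE a1 !affM ?mulf_neq0 ?invr_eq0 //.
  by congr aff; rewrite /d; field; rewrite c0 b0.
(* The commutator of u with the translation by d is the translation by ad - d, and d solves ad - d =
   c. *)
pose d := c / (a - 1).
have a10 : a - 1 != 0 by rewrite subr_eq0.
pose t := aff 1 d; suff -> : aff 1 c = (u ^ t * u^-1)%g.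
  by rewrite groupM ?groupV ?nJ ?mem_aff.
rewrite /conjg /t uE !affV // !affM ?mulf_neq0 ?invr_eq0 //.
by congr aff; rewrite /d; field; rewrite ?a10 ?a0 ?n1.
Qed.

Lemma normal_sum_Aff : normal_sum (Aff F) = (1 + #|F| * sigma (#|F| - 1))%N.
Proof.
rewrite -card_quotient_ker_linear_part -card_ker_linear_part.
apply: normal_sum_cyclic_quotient; first exact: ker_normal.
- by rewrite -cardG_gt1 card_ker_linear_part card_finRing_gt1.
- by rewrite (isog_cyclic quotient_ker_linear_part) field_unit_group_cyclic.
exact: ker_linear_part_minimal.
Qed.

End AffineGroupStructure.

Theorem proposition4p2 :
  (forall (q : nat) (F : finFieldType), prime_power q -> #|F| = q ->
     ~ Leinster (Aff F)) /\
  ((exists (q : nat) (F : finFieldType),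
      [/\ prime_power q, #|F| = q, cyclic (Aff F) & #|Aff F| = 2]) /\
   (forall (q : nat) (F : finFieldType), prime_power q -> #|F| = q ->
      (almost_Leinster (Aff F) <-> cyclic (Aff F) /\ #|Aff F| = 2))) /\
  (forall (q : nat) (F : finFieldType), prime_power q -> #|F| = q ->
     (quasi_Leinster (Aff F) <-> prime q /\ perfect (q - 1))).
Proof.
split=> [q F _ Fq|]; last split; first last.
- move=> q F qp Fq; rewrite /quasi_Leinster normal_sum_Aff card_Aff Fq.
  have q1 : 1 < q by rewrite -Fq card_finRing_gt1.
  split=> [E|[_ [_ E]]]; last by rewrite -/(sigma _) in E; rewrite E; nia.
  have pf : perfect (q - 1).
    split; first by rewrite subn_gt0.
    apply/eqP; rewrite -(eqn_pmul2l (_ : 0 < q)) ?(ltnW q1) // -/(sigma _).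
    by apply/eqP; nia.
  by split=> //; apply: perfect_prime_power_pred.
- split.
    exists 2, 'F_2; have c2 : #|Aff 'F_2| = 2 by rewrite card_Aff card_Fp.
    split=> //; first by exists 2, 1.
      by rewrite card_Fp.
    by rewrite prime_cyclic ?c2.
  move=> q F _ Fq; rewrite /almost_Leinster normal_sum_Aff card_Aff Fq.
  have q1 : 1 < q by rewrite -Fq card_finRing_gt1.
  split=> [E|[_ E]].
    (* With the subtraction of 1 moved across, [E] says q sigma(q-1) + 2 = 2q(q-1). *)
    have /dvdn_leq q2 : q %| 2.
      rewrite -(dvdn_addr 2 (dvdn_mulr (sigma (q - 1)) (dvdnn q))).
      have -> : q * sigma (q - 1) + 2 = q * (2 * (q - 1)) by nia.
      exact: dvdn_mulr.
    have qE : q = 2 by apply/eqP; rewrite eqn_leq q2.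
    have c2 : #|Aff F| = 2 by rewrite card_Aff Fq qE.
    by split; [rewrite prime_cyclic ?c2 | rewrite qE].
  have -> : q = 2 by nia.
  by rewrite /sigma big_cons big_nil.
rewrite /Leinster normal_sum_Aff card_Aff Fq => E.
have q1 : 1 < q by rewrite -Fq card_finRing_gt1.
have : q %| 1.
  rewrite -(dvdn_addl 1 (dvdn_mulr (sigma (q - 1)) (dvdnn q))) E.
  by rewrite mulnCA dvdn_mulr.
by rewrite dvdn1; case: eqP q1 => // ->.
Qed.
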